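(* Let $\Omega$ be an infinite set. Then the group $\mathrm{Sym}(\Omega)$ of all permutations of $\Omega$ is almost $2^{|\Omega|}$-free, with respect to the function topology.
   Context: The function topology on $\mathrm{Sym}(\Omega)$ is the topology with subbasis of open sets $\{f \in \mathrm{Sym}(\Omega) : f(\alpha)=\beta\}$, $\alpha,\beta\in\Omega$; it makes $\mathrm{Sym}(\Omega)$ a Hausdorff topological group. For a cardinal $\kappa>0$ and a group $G$, let $G_\kappa$ denote the set of $\kappa$-tuples $(g_i)_{i\in\kappa}\in G^\kappa$ that freely generate a free subgroup of $G$, i.e. such that no nontrivial reduced group word in the indexed variables $(x_i)_{i\in\kappa}$ evaluates to $1$ at $(g_i)_{i\in\kappa}$ (equivalently, the homomorphism from the free group on $\{x_i\}_{i\in\kappa}$ to $G$ sending $x_i\mapsto g_i$ is injective). An infinite topological group $G$ is called almost $\kappa$-free if $G_\kappa$ is dense in $G^\kappa$ with the product topology. *)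

(* Defs.v *)
From HB Require Import structures.
From mathcomp Require Import all_boot finmap all_classical all_analysis.

Set Implicit Arguments.
Unset Strict Implicit.
Unset Printing Implicit Defensive.

Local Open Scope classical_set_scope.
Local Open Scope group_scope.

HB.mixin Record isTopologicalGroup G & Topological G & Group G := {
  mulg_continuous : continuous (fun x : G * G => x.1 * x.2) ;
  invg_continuous : continuous (fun x : G => x^-1)
}.

#[short(type="topologicalGroupType")]
HB.structure Definition TopologicalGroup :=
  {G of Topological G & Group G & isTopologicalGroup G}.

(* A letter (i, true) stands for x_i and (i, false) for its inverse. *)
Definition word (I : Type) := seq (I * bool).

Definition reduced_word (I : Type) (w : word I) : bool :=
  sorted (fun a b : I * bool => ~~ `[< a.1 = b.1 /\ a.2 = ~~ b.2 >]) w.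

Definition eval_word (I : Type) (G : groupType) (g : I -> G) (w : word I) : G :=
  \prod_(a <- w) (if a.2 then g a.1 else (g a.1)^-1).

Definition free_tuples (I : Type) (G : groupType) : set (I -> G) :=
  [set g | forall w : word I, reduced_word w -> w <> [::] -> eval_word g w <> 1].

(* The index type I stands for a set of cardinality kappa in "almost kappa-free". *)
Definition almost_free (I : Type) (G : topologicalGroupType) : Prop :=
  infinite_set [set: G] /\ dense (@free_tuples I G : set {ptws I -> G}).

Record Sym (Omega : Type) := MkSym {
  sym_fun :> Omega -> Omega ;
  sym_bij : bijective sym_fun
}.

HB.instance Definition _ (Omega : Type) := gen_eqMixin (Sym Omega).
HB.instance Definition _ (Omega : Type) := gen_choiceMixin (Sym Omega).

Section SymGroup.
Context {Omega : Type}.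
Implicit Types f g h : Sym Omega.

Lemma symP f g : f =1 g -> f = g.
Proof.
case: f g => [f bf] [g bg] /= /funext fg; rewrite fg in bf *.
by congr MkSym; exact: Prop_irrelevance.
Qed.

Definition sym_one : Sym Omega := MkSym (Bijective (frefl id) (frefl id)).

Definition sym_mul f g : Sym Omega := MkSym (bij_comp (sym_bij f) (sym_bij g)).

Lemma sym_inv_subproof f : exists g, cancel g f /\ cancel f g.
Proof.
case: (sym_bij f) => k fk kf; have bk : bijective k by exists f.
by exists (MkSym bk).
Qed.

Definition sym_inv f : Sym Omega := projT1 (cid (sym_inv_subproof f)).

Lemma sym_invK f : cancel (sym_inv f) f.
Proof. by rewrite /sym_inv; case: cid => g []. Qed.

Lemma symK f : cancel f (sym_inv f).
Proof. by rewrite /sym_inv; case: cid => g []. Qed.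

Lemma sym_mulA : associative sym_mul.
Proof. by move=> f g h; exact: symP. Qed.

Lemma sym_mul1 : left_id sym_one sym_mul.
Proof. by move=> f; exact: symP. Qed.

Lemma sym_mulr1 : right_id sym_one sym_mul.
Proof. by move=> f; exact: symP. Qed.

Lemma sym_mulV : left_inverse sym_one sym_inv sym_mul.
Proof. by move=> f; apply: symP => a /=; rewrite symK. Qed.

Lemma sym_mulrV : right_inverse sym_one sym_inv sym_mul.
Proof. by move=> f; apply: symP => a /=; rewrite sym_invK. Qed.

HB.instance Definition _ := isGroup.Build (Sym Omega)
  sym_mulA sym_mul1 sym_mulr1 sym_mulV sym_mulrV.

(* The function topology; the subbasis is indexed by its own members because
   the factory requires a pointed index type, which Omega * Omega need not be. *)
Definition sym_subbase : set (set (Sym Omega)) :=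
  [set U | exists a b : Omega, U = [set f : Sym Omega | f a = b]].

HB.instance Definition _ :=
  @isSubBaseTopological.Build (Sym Omega) (set (Sym Omega)) sym_subbase id.

Lemma nbhs_sym_app f a : nbhs f [set g : Sym Omega | g a = f a].
Proof.
rewrite nbhsE; exists [set g : Sym Omega | g a = f a] => //; split => //.
exists [set [set g : Sym Omega | g a = f a]]; last first.
  rewrite predeqE => g; split=> [[_ ->]|ga]; first by [].
  by exists [set h | h a = f a].
move=> _ ->; exists [fset [set g : Sym Omega | g a = f a]]%fset.
  by move=> U; move/fset1P => ->; rewrite inE; exists a, (f a).
rewrite predeqE => g; split=> [|ga U /=]; last by move/fset1P => ->.
by move=> /(_ [set h | h a = f a]); apply; exact/fset1P.
Qed.

Lemma cvg_sym (F : set_system (Sym Omega)) f : Filter F ->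
  (forall a, F [set g : Sym Omega | g a = f a]) -> F --> f.
Proof.
move=> FF Ff A; rewrite nbhsE => -[_ [[B sB <-] [C BC Cf] sUA]].
rewrite nbhs_filterE; apply: filterS sUA _; apply: (@filterS _ _ _ C).
  by move=> g Cg; exists C.
have /sB [D sD IDC] := BC; rewrite -IDC; apply: filter_bigI => U DU.
have /sD := DU; rewrite inE => -[a [b Uab]].
have : U f by move: Cf; rewrite -IDC => /(_ _ DU).
by rewrite Uab /= => <-; exact: Ff.
Qed.

Lemma sym_mulg_continuous :
  continuous (fun x : Sym Omega * Sym Omega => x.1 * x.2).
Proof.
move=> [f g]; apply: cvg_sym => a.
exists ([set f' : Sym Omega | f' (g a) = f (g a)],
        [set g' : Sym Omega | g' a = g a]).
  by split; exact: nbhs_sym_app.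
by move=> [f' g'] /= [f'E g'E]; rewrite /= /mul /= g'E.
Qed.

Lemma sym_invg_continuous : continuous (fun f : Sym Omega => f^-1).
Proof.
move=> f; apply: cvg_sym; first exact: (@fmap_filter _ _ _ (nbhs f) (nbhs_filter f)).
move=> a; apply: filterS (nbhs_sym_app f (sym_inv f a)) => g /=.
rewrite sym_invK => ga; rewrite -[in LHS]ga; exact: symK.
Qed.

HB.instance Definition _ := isTopologicalGroup.Build (Sym Omega)
  sym_mulg_continuous sym_invg_continuous.

End SymGroup.

(* Main.v *)
(** For a finite sequence F of points, each subset A of Omega has a trace on F,
    a bit sequence, and the free group on all bit sequences acts on itself by
    left multiplication. Let A act on the pairs (F, u), with u a reduced word in
    bit sequences, by multiplying u on the left by the trace of A on F. Given a
    nontrivial reduced word w in subsets of Omega, some F separates the subsets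
    occurring in w, and then w moves (F, 1) to (F, trace of w), so the subsets
    of Omega act freely independently. Since Omega is infinite, the set of these
    pairs embeds in Omega, even off any prescribed finite set; a basic open set
    of tuples contains a tuple of permutations supported on a common finite set,
    which can be multiplied by the free action transported off that set. *)

Require Import Defs.
From mathcomp Require Import all_boot all_classical all_analysis.

Set Implicit Arguments.
Unset Strict Implicit.
Unset Printing Implicit Defensive.

Local Open Scope classical_set_scope.

(** * Comparability of sets under injections *)

(** A maximal partial injection, viewed as its graph, has domain [A] or range [B]: otherwise a pair
    of unmatched points could be added. *)
Lemma partial_injection_total (T : Type) (A B : set T) :
  (exists2 f : T -> T, {in A &, injective f} & {homo f : x / A x >-> B x}) \/
  (exists2 f : T -> T, {in B &, injective f} & {homo f : x / B x >-> A x}).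
Proof.
pose P (R : set (T * T)) := [/\ R `<=` A `*` B,
  forall x y z, R (x, y) -> R (x, z) -> y = z &
  forall x y z, R (x, z) -> R (y, z) -> x = y].
have [F FP Ftot|R [[RAB Rf Ri] Rmax]] := @Zorn_bigcup _ P.
  have FU p q : (\bigcup_(X in F) X) p -> (\bigcup_(X in F) X) q ->
      exists R, [/\ P R, R p & R q].
    move=> [R FR Rp] [S FS Sq]; have [RS|SR] := Ftot _ _ FR FS.
      by exists S; split; [exact: FP|exact: RS|].
    by exists R; split; [exact: FP| |exact: SR].
  split=> [p [R /FP[RAB _ _] /RAB//]|x y z|x y z] Rp Rq.
    by have [R [[_ Rf _] /Rf]] := FU _ _ Rp Rq; apply.
  by have [R [[_ _ Ri] /Ri]] := FU _ _ Rp Rq; apply.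
have [RA|/existsNP[a /not_implyP[Aa nRa]]] :=
    pselect (forall x, A x -> exists y, R (x, y)).
  left; have [f Rfx] : {f & forall x, A x -> R (x, f x)}.
    apply: (choice (P := fun x y => A x -> R (x, y))) => x.
    by have [/RA[y]|] := pselect (A x); [exists y|exists x].
  exists f => [x y /set_mem Ax /set_mem Ay fxy|x /Rfx/RAB[]//].
  by apply: (Ri _ _ (f x)); [|rewrite fxy]; exact: Rfx.
right; have [RB|/existsNP[b /not_implyP[Bb nRb]]] :=
    pselect (forall y, B y -> exists x, R (x, y)).
  have [f Rfx] : {f & forall x, B x -> R (f x, x)}.
    apply: (choice (P := fun x y => B x -> R (y, x))) => x.
    by have [/RB[y]|] := pselect (B x); [exists y|exists x].
  exists f => [x y /set_mem Ax /set_mem Ay fxy|x /Rfx/RAB[]//].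
  by apply: (Rf (f x)); [|rewrite fxy]; exact: Rfx.
exfalso; apply: (Rmax (R `|` [set (a, b)])).
  rewrite properEneq; split; last by move=> ?; left.
  apply/eqP => RE; apply: nRa; exists b; rewrite RE; by right.
split=> [p [/RAB//|->//]|x y z|x y z].
- move=> [Rxy|[xa' yb]] [Rxz|[xa zb]].
  + exact: Rf Rxy Rxz.
  + by exfalso; apply: nRa; exists y; rewrite -xa.
  + by exfalso; apply: nRa; exists z; rewrite -xa'.
  + by rewrite yb zb.
- move=> [Rxy|[xa zb']] [Rxz|[ya zb]].
  + exact: Ri Rxy Rxz.
  + by exfalso; apply: nRb; exists x; rewrite -zb.
  + by exfalso; apply: nRb; exists y; rewrite -zb'.
  + by rewrite xa ya.
Qed.

Lemma infinite_nat_injection (T : Type) : infinite_set [set: T] ->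
  exists e : nat -> T, injective e.
Proof.
elim/Ppointed: T => T; first by rewrite emptyE => /(_ (finite_set0 _)).
move=> /infiniteP/pcard_leTP[e]; exists e => m n.
by apply: (inj (f := e)); exact: in_setT.
Qed.

(** * Embedding the finite sequences over an infinite type in the type *)

Section SeqInjection.
Variable T : Type.
Implicit Types (D : set T) (f : seq T -> T) (s : seq T).

Definition seq_over D s := all (fun x => `[< D x >]) s.

Definition seq_injection_on D f :=
  (forall s, seq_over D s -> D (f s)) /\
  (forall s t, seq_over D s -> seq_over D t -> f s = f t -> s = t).

(* A finite sequence over D and the domain of r is encoded over D by
   tagging each entry with a or b according to whether r has to be applied. *)
Definition tagged_seq D (r : T -> T) (a b : T) s :=
  flatten [seq if `[< D x >] then [:: a; x] else [:: b; r x] | x <- s].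

Lemma tagged_seq_over D (X : set T) r a b s : D a -> D b ->
  (forall x, X x -> ~ D x -> D (r x)) ->
  seq_over X s -> seq_over D (tagged_seq D r a b s).
Proof.
move=> Da Db rD; elim: s => //= x s IH /andP[/asboolP Xx /IH{}IH].
rewrite /tagged_seq /= /seq_over all_cat [all _ (flatten _)]IH andbT.
by case: asboolP => Dx; apply/and3P; split=> //; apply/asboolP => //; exact: rD.
Qed.

(** All blocks have length two, so they align, and the tag says how to decode the second entry. *)
Lemma tagged_seq_inj D (X : set T) r a b s t : a <> b ->
  (forall x y, X x -> X y -> ~ D x -> ~ D y -> r x = r y -> x = y) ->
  seq_over X s -> seq_over X t ->
  tagged_seq D r a b s = tagged_seq D r a b t -> s = t.
Proof.
move=> ab rI; rewrite /tagged_seq.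
elim: s t => [|x s IH] [|y t] //=; first by case: ifP.
  by case: ifP.
move=> /andP[/asboolP Xx Xs] /andP[/asboolP Xy Xt].
case: asboolP => Dx; case: asboolP => Dy /= [].
- by move=> -> /IH ->.
- by move=> /ab.
- by move=> /esym/ab.
- by move=> /rI -> // /IH ->.
Qed.

Lemma seq_injection_neq D f : seq_injection_on D f ->
  exists a b, [/\ D a, D b & a <> b].
Proof.
move=> [fD fI]; have Da : D (f [::]) by exact: fD.
have sa : seq_over D [:: f [::]] by rewrite /seq_over /= andbT; apply/asboolP.
exists (f [::]), (f [:: f [::]]); split=> //; first exact: fD.
by move/fI => /(_ isT sa).
Qed.

(* Zorn's lemma on the pairs (D, f) with f injective from the finite sequences
   over D to D: for a maximal D, the complement of D embeds in D, since an
   image of D outside D would allow an extension of f. *)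
Lemma infinite_seq_injection : infinite_set [set: T] ->
  exists f : seq T -> T, injective f.
Proof.
move=> /infinite_nat_injection[e eI].
pose S := {Df : set T * (seq T -> T) | `[< seq_injection_on Df.1 Df.2 >]}.
(* Values off the sequences over the first component are disregarded, so [R] need not be
   antisymmetric. *)
pose R (p q : S) := `[< (val p).1 `<=` (val q).1 /\
  forall s, seq_over (val p).1 s -> (val p).2 s = (val q).2 s >].
have RP p q : reflect ((val p).1 `<=` (val q).1 /\
    forall s, seq_over (val p).1 s -> (val p).2 s = (val q).2 s) (R p q).
  exact: asboolP.
have overS D D' s : D `<=` D' -> seq_over D s -> seq_over D' s.
  move=> DD'; apply: sub_all => x /asboolP Dx; apply/asboolP; exact: DD'.
have base : S.
  have [e' e'K] : {e' : T -> nat & forall x, (exists n, e n = x) -> e (e' x) = x}.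
    apply: (choice (P := fun x n => (exists n, e n = x) -> e n = x)) => x.
    by have [[n <-]|] := pselect (exists n, e n = x); [exists n|exists 0].
  exists (range e, fun s => e (pickle (map e' s))); apply/asboolP.
  have eK s : seq_over (range e) s -> map e (map e' s) = s.
    elim: s => //= x s IH /andP[/asboolP[n _ enx] /IH ->].
    by rewrite e'K//; exists n.
  split=> /= [s _|s t /eK {2}<- /eK {2}<-]; first by eexists.
  move=> /eI st; congr map; exact: (pcan_inj pickleK).
have [||A Atot|[[D f] /= fP] maxf] := @ZL_preorder S base R.
- by move=> p; apply/RP; split.
- move=> r p q /RP[rp rpE] /RP[pq pqE]; apply/RP.
  split=> [|s rs]; first exact: subset_trans pq.
  by rewrite rpE// pqE//; exact: overS rs.
- have [[p0 Ap0]|A0] := pselect (exists p, A p); last first.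
    by exists base => p Ap; case: A0; exists p.
  (* The union bounds a nonempty chain: finitely many entries lie in one member, which determines
     the value of [f]. *)
  pose U := \bigcup_(p in A) (val p).1.
  have Rtot p q : A p -> A q -> exists2 r, A r & R p r /\ R q r.
    move=> Ap Aq; have [pq|qp] := Atot _ _ Ap Aq; [exists q|exists p] => //.
      by split=> //; apply/RP; split.
    by split=> //; apply/RP; split.
  have US s : seq_over U s -> exists2 p, A p & seq_over (val p).1 s.
    elim: s => [|x s IH] /=; first by exists p0.
    move=> /andP[/asboolP[p Ap px] /IH[q Aq qs]].
    have [r Ar [/RP[pr _] /RP[qr _]]] := Rtot _ _ Ap Aq.
    by exists r => //; apply/andP; split; [apply/asboolP; exact: pr|exact: overS qs].
  have [f fE] : {f & forall s, seq_over U s ->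
      exists p, [/\ A p, seq_over (val p).1 s & f s = (val p).2 s]}.
    apply: (choice (P := fun s y => seq_over U s ->
      exists p, [/\ A p, seq_over (val p).1 s & y = (val p).2 s])) => s.
    have [/US[p Ap ps]|nUs] := pselect (seq_over U s); last by exists (e 0).
    by exists ((val p).2 s) => _; exists p.
  have fA p s : A p -> seq_over (val p).1 s -> (val p).2 s = f s.
    move=> Ap ps; have Us : seq_over U s by apply: overS ps => x px; exists p.
    have [q [Aq qs ->]] := fE _ Us.
    by have [r _ [/RP[_ ->//] /RP[_ ->]]] := Rtot _ _ Ap Aq.
  have Uf : `[< seq_injection_on U f >].
    apply/asboolP; split=> [s Us|s t Us Ut].
      have [p [Ap ps ->]] := fE _ Us; exists p => //.
      by have /asboolP[+ _] := valP p; apply.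
    have [p Ap ps] := US _ Us; have [q Aq qt] := US _ Ut.
    have [r Ar [/RP[pr _] /RP[qr _]]] := Rtot _ _ Ap Aq.
    have rs := overS _ _ _ pr ps; have rt := overS _ _ _ qr qt.
    by rewrite -(fA r)// -(fA r t)//; have /asboolP[_] := valP r; apply.
  exists (exist _ (U, f) Uf) => p Ap; apply/RP; split=> /= [x px|s ps].
    by exists p.
  exact: fA.
have /= [fD fI] := asboolP _ fP.
have [a [b [Da Db ab]]] := seq_injection_neq (conj fD fI).
have [[r rI rD]|[h hI hD]] := partial_injection_total (~` D) D.
  have allT s : seq_over [set: T] s.
    elim: s => //= x s; rewrite /seq_over /= => ->.
    by rewrite andbT; apply/asboolP.
  exists (fun s => f (tagged_seq D r a b s)) => s t /fI st.
  have tagD u : seq_over D (tagged_seq D r a b u).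
    by apply: (@tagged_seq_over D [set: T]) => // x _; exact: rD.
  apply: (@tagged_seq_inj D [set: T] r a b) => //; last by apply: st.
  by move=> x y _ _ Dx Dy; apply: rI; exact/mem_set.
exfalso.
pose D' := D `|` h @` D.
have [r rK] : {r : T -> T & forall x, D x -> r (h x) = x}.
  have [r rK] : {r : T -> T & forall x, (h @` D) x -> D (r x) /\ h (r x) = x}.
    apply: (choice (P := fun x y => (h @` D) x -> D y /\ h y = x)) => x.
    by have [[y Dy <-]|] := pselect ((h @` D) x); [exists y|exists x].
  exists r => x Dx; have [Dr hr] : D (r (h x)) /\ h (r (h x)) = h x.
    by apply: rK; exists x.
  by apply: hI => //; exact/mem_set.
(* [r] brings entries outside [D] back into [D]; the outer [h] keeps the new values apart from the
   old ones, which lie in [D]. *)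
pose f' s := if seq_over D s then f s else h (f (tagged_seq D r a b s)).
have tagD s : seq_over D' s -> seq_over D (tagged_seq D r a b s).
  by apply: tagged_seq_over => // x [//|[y Dy <-]] _; rewrite rK.
have f'P : `[< seq_injection_on (D', f').1 (D', f').2 >].
  apply/asboolP; split=> /= [s D's|s t D's D't]; rewrite /f'.
    case: ifP => [Ds|_]; first by left; exact: fD.
    by right; exists (f (tagged_seq D r a b s)) => //; apply/fD/tagD.
  have hfD u : seq_over D' u -> ~ D (h (f (tagged_seq D r a b u))).
    by move=> D'u; apply/hD/fD/tagD.
  case: ifP => Ds; case: ifP => Dt.
  - exact: fI.
  - by move=> fE; case: (hfD t) => //; rewrite -fE; exact: fD.
  - by move=> fE; case: (hfD s) => //; rewrite fE; exact: fD.
  - move=> /hI; rewrite !inE => /(_ (fD _ (tagD _ D's)) (fD _ (tagD _ D't))).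
    move=> /(fI _ _ (tagD _ D's) (tagD _ D't)).
    apply: (tagged_seq_inj (X := D')) => //.
    by move=> x y [//|[x' Dx <-]] [//|[y' Dy <-]] _ _; rewrite !rK// => ->.
have /RP[/= D'D _] : R (exist _ (D', f') f'P) (exist _ (D, f) fP).
  apply: maxf; apply/RP; split=> /= [x|s Ds]; first by left.
  by rewrite /f' Ds.
by apply: (hD a Da); apply: D'D; right; exists a.
Qed.

End SeqInjection.

(** * Reduced words and left multiplication by a letter *)

Definition inv_letter (L : Type) (a : L * bool) : L * bool := (a.1, ~~ a.2).

Lemma inv_letterK L : involutive (@inv_letter L).
Proof. by case=> i b; rewrite /inv_letter /= negbK. Qed.

Lemma reduced_word_cons2 (L : Type) (a b : L * bool) (w : word L) :
  reduced_word [:: a, b & w] = ~~ `[< a = inv_letter b >] && reduced_word (b :: w).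
Proof.
rewrite /reduced_word /=; congr (~~ _ && _); apply: asbool_equiv_eq.
by case: a b => [i s] [j t]; split=> /= [[-> ->]|[]].
Qed.

(* Left multiplication in the free group; leaving the unreduced words fixed
   makes it a bijection of the type of all words. *)
Definition push_letter (L : Type) (a : L * bool) (u : word L) : word L :=
  if ~~ reduced_word u then u else
  if u is b :: u' then if `[< a = inv_letter b >] then u' else a :: u
  else [:: a].

Lemma push_letterK (L : Type) (a : L * bool) :
  cancel (push_letter a) (push_letter (inv_letter a)).
Proof.
move=> u; rewrite {2}/push_letter; case: ifPn => [nu|].
  by rewrite /push_letter nu.
rewrite negbK; case: u => [|b u] ru; first by rewrite /push_letter /= asboolT.
case: asboolP => [ab|/asboolF ab]; last first.
  by rewrite /push_letter reduced_word_cons2 ab ru/= asboolT.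
rewrite ab inv_letterK /push_letter.
case: u ru => [//|c u]; rewrite reduced_word_cons2 => /andP[/negPf bc ->] /=.
by rewrite bc.
Qed.

Lemma push_letter_reduced (L : Type) (a : L * bool) (w : word L) :
  reduced_word (a :: w) -> push_letter a w = a :: w.
Proof.
case: w => // b w; rewrite reduced_word_cons2 => /andP[/negPf ab rw].
by rewrite /push_letter rw ab.
Qed.

(** * The free action of subsets through their traces *)

Section TraceAction.
Variable T : Type.

Definition trace (A : set T) (F : seq T) : bitseq := [seq `[< A x >] | x <- F].

Definition trace_word (F : seq T) (w : word (set T)) : word bitseq :=
  [seq (trace a.1 F, a.2) | a <- w].

Lemma trace_neq (A B : set T) : A <> B -> exists x, `[< A x >] <> `[< B x >].
Proof.
move=> AB; apply/not_existsP => ABx; apply: AB; apply/funext => x.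
have /contrapT ABE := ABx x.
by apply/propext; split=> /asboolP; [rewrite ABE|rewrite -ABE] => /asboolP.
Qed.

(** Only adjacent letters matter: if their sets agree, their signs are not opposite; otherwise a
    point where the sets differ separates the traces. *)
Lemma separating_seq (w : word (set T)) :
  reduced_word w -> exists F, reduced_word (trace_word F w).
Proof.
elim: w => [|a [|b w] IH]; [by exists [::]|by exists [::]|].
rewrite reduced_word_cons2 => /andP[/asboolP ab /IH[F rF]].
(* Lengthening [F] refines the traces, so it creates no cancellation. *)
have mono x : reduced_word (trace_word (x :: F) (b :: w)).
  move: rF; rewrite /reduced_word /trace_word !sorted_map.
  apply: sub_sorted => c d /=; apply: contra => /asboolP[+ cd].
  by move=> [_ ?]; apply/asboolP.
have [ab1|/trace_neq[x abx]] := pselect (a.1 = b.1).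
  exists F; rewrite [trace_word _ _]/= reduced_word_cons2 rF andbT.
  apply/asboolP => -[_ ab2].
  by apply: ab; rewrite [LHS]surjective_pairing ab1 ab2.
exists (x :: F); rewrite [trace_word _ _]/= reduced_word_cons2.
rewrite -/(trace_word _ (b :: w)) mono andbT.
by apply/asboolP => -[/abx].
Qed.

Definition trace_push (A : set T) (s : bool) (y : seq T * word bitseq) :=
  (y.1, push_letter (trace A y.1, s) y.2).

Lemma trace_pushK A s : cancel (trace_push A s) (trace_push A (~~ s)).
Proof.
by case=> F u; rewrite /trace_push /=; congr pair; exact: (push_letterK (_, s)).
Qed.

(** The pushes build a reduced word without cancelling, so a trivial value of [w] would make
    [trace_word F w] empty. Off the range of [j] the permutations may be arbitrary, which leaves
    room to prescribe values. *)
Lemma trace_push_free (U : Type) (g : set T -> Sym U)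
    (j : seq T * word bitseq -> U) :
  injective j -> (forall A y, g A (j y) = j (trace_push A true y)) ->
  free_tuples g.
Proof.
move=> jI gj w rw w0 gw; have [F rF] := separating_seq rw; apply: w0.
have gVj A y : (g A)^-1%g (j y) = j (trace_push A false y).
  by rewrite -{1}(@trace_pushK A false y) -gj; exact: symK.
suff jw : eval_word g w (j (F, [::])) = j (F, trace_word F w).
  by move: jw; rewrite gw => /jI[]; case: w {rw gw rF}.
elim: w rF {rw gw} => [_|a w IH rF]; first by rewrite /eval_word big_nil.
rewrite /eval_word big_cons -/(eval_word g w).
have /IH wE : reduced_word (trace_word F w) by exact: path_sorted rF.
transitivity (j (trace_push a.1 a.2 (F, trace_word F w))).
  rewrite [LHS]/= wE.
  by case: a.2; [rewrite gj|rewrite gVj].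
by rewrite /trace_push /= push_letter_reduced.
Qed.

End TraceAction.

(** * Transport along an injection that avoids a finite set *)

Section Transport.
Variables (X T : Type) (j : X -> T).
Hypothesis jI : injective j.

Definition transport (f : X -> X) (x : T) : T :=
  if pselect (exists y, j y = x) is left e then j (f (projT1 (cid e))) else x.

Lemma transport_in f y : transport f (j y) = j (f y).
Proof.
rewrite /transport; case: pselect => [e|[]]; last by exists y.
by congr (j (f _)); apply: jI; case: cid.
Qed.

Lemma transport_out f x : (forall y, j y <> x) -> transport f x = x.
Proof. by rewrite /transport; case: pselect => // -[y jy] /(_ y). Qed.

Lemma transportK f f' : cancel f f' -> cancel (transport f) (transport f').
Proof.
move=> fK x; have [[y <-]|nx] := pselect (exists y, j y = x).
  by rewrite !transport_in fK.
by rewrite !transport_out// => y jy; apply: nx; exists y.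
Qed.

End Transport.

(** A point of [S] in every copy of [X] would inject the naturals into a finite set. *)
Lemma infinite_avoid (X T : Type) (e : X * nat -> T) (S : set T) :
  injective e -> finite_set S -> exists n, forall x, ~ S (e (x, n)).
Proof.
move=> eI fS; apply: contrapT => /forallNP nS.
have [x xS] : {x : nat -> X & forall n, S (e (x n, n))}.
  by apply: (choice (P := fun n x => S (e (x, n)))) => n;
    have /existsNP[x /contrapT] := nS n; exists x.
apply: infinite_nat; have -> : [set: nat] = (fun n => e (x n, n)) @^-1` S.
  by apply/seteqP; split=> // n _; exact: xS.
by apply: finite_preimage fS => m n _ _ /eI[].
Qed.

(** * Transpositions and finitely supported permutations *)

Section Swap.
Variables (T : Type) (a b : T).

Definition swap_fun (x : T) : T :=
  if `[< x = a >] then b else if `[< x = b >] then a else x.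

Lemma swap_funK : involutive swap_fun.
Proof.
move=> x; rewrite /swap_fun; case: (asboolP (x = a)) => [->|xa].
  by case: asboolP => [//|_]; rewrite asboolT.
case: (asboolP (x = b)) => [->|xb]; first by rewrite asboolT.
by rewrite !asboolF.
Qed.

Definition swap : Sym T := MkSym (Bijective swap_funK swap_funK).

Lemma swapL : swap a = b.
Proof. by rewrite /= /swap_fun asboolT. Qed.

Lemma swapD x : x <> a -> x <> b -> swap x = x.
Proof. by move=> xa xb; rewrite /= /swap_fun !asboolF. Qed.

End Swap.

Lemma sym_inj (T : Type) (f : Sym T) : injective f.
Proof. exact: bij_inj (sym_bij f). Qed.

Lemma infinite_Sym (T : Type) :
  infinite_set [set: T] -> infinite_set [set: Sym T].
Proof.
move=> /infinite_nat_injection[e eI] fS.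
apply: infinite_nat.
(* The image of [e 0] tells these swaps apart; [n = 0] gives the identity. *)
have -> : [set: nat] = (fun n => swap (e 0) (e n)) @^-1` [set: Sym T] by [].
apply: finite_preimage fS => m n _ _ /(congr1 (@sym_fun T)) mn.
by apply: eI; rewrite -(swapL (e 0) (e m)) mn swapL.
Qed.

(** Composing with a transposition corrects [p i] at [a]; by injectivity of [p i] and [g i] it
    spoils no value already correct. [S] also holds the constrained points, so that a permutation
    fixing [S] pointwise can be applied before [p i]. *)
Lemma finitely_supported_approx (I T : Type) (g : I -> Sym T) (s : seq (I * T)) :
  exists (p : I -> Sym T) (S : set T), [/\ finite_set S,
    forall i x, ~ S x -> p i x = x &
    all (fun c => `[< p c.1 c.2 = g c.1 c.2 /\ S c.2 >]) s].
Proof.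
elim: s => [|[i a] s [p [S [fS pS ps]]]].
  by exists (fun=> 1%g), set0; split=> //; exact: finite_set0.
pose q j : Sym T := if `[< j = i >] then (swap (p i a) (g i a) * p i)%g else p j.
exists q, (S `|` [set p i a; g i a] `|` [set a]); split.
- by rewrite !finite_setU; do !split.
- move=> j x /not_orP[/not_orP[Sx /not_orP[xp xg]] _]; rewrite /q.
  case: asboolP => [_|_]; last exact: pS.
  by rewrite -[LHS]/(swap _ _ (p i x)) (pS i x Sx) swapD.
- rewrite /=; apply/andP; split.
    by apply/asboolP; split; [rewrite /q asboolT//; exact: swapL|right].
  apply: sub_all ps => -[j x] /= /asboolP[pg Sx]; apply/asboolP.
  split; last by left; left.
  rewrite /q; case: asboolP => // ji; rewrite {}ji in pg *.
  rewrite -[LHS]/(swap _ _ (p i x)).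
  have [xa|xa] := pselect (x = a); first by rewrite -xa -pg; exact: swapL.
  rewrite swapD//; first by move=> pxa; apply: xa; exact: sym_inj pxa.
  by rewrite pg => gxa; apply: xa; exact: sym_inj gxa.
Qed.

(** * Density in the product topology *)

(** The sets satisfying the conclusion in place of [O] form a filter; it converges to [g] in each
    coordinate, hence in the product, and so contains [O]. *)
Lemma ptws_open_coordinates (I T : Type) (O : set {ptws I -> Sym T})
    (g : I -> Sym T) : open O -> O g ->
  exists s : seq (I * T), forall h : I -> Sym T,
    all (fun c => `[< h c.1 c.2 = g c.1 c.2 >]) s -> O h.
Proof.
move=> oO Og.
pose F : set_system {ptws I -> Sym T} := fun A => exists s : seq (I * T),
  forall h : I -> Sym T, all (fun c => `[< h c.1 c.2 = g c.1 c.2 >]) s -> A h.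
have FF : Filter F.
  split; first by exists [::].
  - move=> A B [s sA] [t tB]; exists (s ++ t) => h; rewrite all_cat => /andP[hs ht].
    by split; [exact: sA|exact: tB].
  - by move=> A B AB [s sA]; exists s => h /sA/AB.
have Fg : F --> (g : {ptws I -> Sym T}).
  apply/cvg_sup => i U [V [[W oW <-] Wg WU]].
  have FW : ((fun h : I -> Sym T => h i) @ F) W.
    have : (fun h : I -> Sym T => h i) @ F --> g i.
      apply: cvg_sym => a; exists [:: (i, a)] => h /=.
      by rewrite andbT => /asboolP.
    by apply; exact: open_nbhs_nbhs.
  rewrite nbhs_filterE; have [u uW] := FW; exists u => h hu.
  by apply: WU; exact: uW.
by apply: Fg; exact: open_nbhs_nbhs.
Qed.

Theorem corollary18 (Omega : Type) (hOmega : infinite_set [set: Omega]) :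
  almost_free (set Omega) (Sym Omega).
Proof.
split; first exact: infinite_Sym.
move=> O [g Og] oO; have [s sO] := ptws_open_coordinates oO Og.
have [p [S [fS pS ps]]] := finitely_supported_approx g s.
have [f fI] := infinite_seq_injection hOmega.
pose a := f [::]; pose b := f [:: a].
have ab : a <> b by move/fI.
(* Words over bit sequences are countable: the word and the copy number become the length of a run
   of [a], ended by [b]. *)
pose e (z : (seq Omega * word bitseq) * nat) :=
  f (nseq (pickle (z.1.2, z.2)) a ++ b :: z.1.1).
have eI : injective e.
  move=> [[F u] m] [[G v] n] /fI /=.
  set k := pickle (u, m); set l := pickle (v, n) => kl.
  suff [/(pcan_inj pickleK)[-> ->] ->] : k = l /\ F = G by [].
  elim: k l kl => [|k IH] [|l] [].
  - by [].
  - by move=> /esym/ab.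
  - by move=> /ab.
  - by move=> /IH[->].
have [n nS] := infinite_avoid eI fS.
pose j y := e (y, n).
have jI : injective j by move=> y z /eI[].
pose t A : Sym Omega := MkSym
  (Bijective (transportK jI (@trace_pushK Omega A true))
             (transportK jI (@trace_pushK Omega A false))).
(* [t A] fixes the constrained points, so [p A] gives the values there; [p A] fixes the range of
   [j], so the product acts there as [t A]. *)
exists (fun A => p A * t A)%g; split.
  apply: sO; apply: sub_all ps => -[A x] /= /asboolP[pg Sx]; apply/asboolP.
  rewrite -pg -[LHS]/(p A (t A x)) [t A x]transport_out// => y jy.
  by apply: (nS y); rewrite -/(j y) jy.
apply: (trace_push_free jI) => A y.
by rewrite -[LHS]/(p A (t A (j y))) [t A _]transport_in// pS//; exact: nS.
Qed.
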